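(* Let $n\ge 1$ be an integer and let $LC_n$ be the Layered Catalan monoid on $n$ generators. Let $\theta_{LC_n}(X)$ be the semigroup determinant of $LC_n$. Then $\theta_{LC_n}(X)\neq 0$ (as a polynomial) if and only if $n<8$.
   Context: Layered Catalan monoid: for $n\ge 1$, $LC_n$ is the monoid with identity $1$ generated by $a_1,\dots,a_n$ subject to the following relations, where generator indices such as $i+1,i+2$ in (5) are read modulo $n$ with representatives in $\{1,\dots,n\}$: (1) $a_i^2=a_i$ for $1\le i\le n$; (2) $a_ia_j=a_ja_i$ for all $1\le i,j\le n$ with $|i-j|>1$ and $\{i,j\}\neq\{1,n\}$; (3) $a_ia_{i+1}a_i=a_{i+1}a_ia_{i+1}=a_{i+1}a_i$ for $1\le i<n$; (4) $a_na_1a_n=a_1a_na_1=a_1a_n$; (5) $a_ia_{i+1}a_{i+2}=a_ia_{i+2}$ for $1\le i\le n$. The monoid $LC_n$ is finite. Semigroup determinant: for a finite semigroup $S$ let $X=\{x_s\mid s\in S\}$ be a set of commuting independent variables in bijection with $S$. The semigroup determinant $\theta_S(X)\in\mathbb{C}[X]$ is the determinant of the $S\times S$ matrix whose $(s,t)$ entry is $x_{st}$. *)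

(* Defs.v *)
From HB Require Import structures.
From mathcomp Require Import all_boot all_algebra.
From mathcomp Require Import boolp mpoly.
From mathcomp Require Import zify.

Set Implicit Arguments.
Unset Strict Implicit.
Unset Printing Implicit Defensive.

#[short(type="finSemigroupType")]
HB.structure Definition FinSemigroup := {S of Semigroup S & Finite S}.

(* The variable x_s is 'X_(enum_rank s); rows and columns are indexed through *)
(* the same bijection, so its choice only relabels the variables.             *)
Definition semigroup_det (K : comNzRingType) (S : finSemigroupType) :
    {mpoly K[#|S|]} :=
  (\det (\matrix_(i < #|S|, j < #|S|)
     'X_(enum_rank (enum_val i * enum_val j)%g)))%R.

(* The least congruence on the free monoid over A containing R. *)

Inductive word_cong (A : Type) (R : seq A -> seq A -> Prop) :
    seq A -> seq A -> Prop :=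
| WordCongRefl u : word_cong R u u
| WordCongSym u v : word_cong R u v -> word_cong R v u
| WordCongTrans u v w : word_cong R u v -> word_cong R v w -> word_cong R u w
| WordCongRel x u v y : R u v -> word_cong R (x ++ u ++ y) (x ++ v ++ y).

Section PresentedMonoid.
Variables (A : choiceType) (R : seq A -> seq A -> Prop).
Local Notation cong := (word_cong R).

Lemma word_congLR x u v y : cong u v -> cong (x ++ u ++ y) (x ++ v ++ y).
Proof.
elim=> [w|v1 v2 _ IH|u1 u2 u3 _ IH1 _ IH2|x' u1 u2 y' Ruv].
- exact: WordCongRefl.
- exact: WordCongSym.
- exact: WordCongTrans IH1 IH2.
- have E s : x ++ (x' ++ s ++ y') ++ y = (x ++ x') ++ s ++ (y' ++ y).
    by rewrite !catA.
  by rewrite !E; apply: WordCongRel.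
Qed.

Lemma word_cong_cat u u' v v' : cong u u' -> cong v v' -> cong (u ++ v) (u' ++ v').
Proof.
move=> Hu Hv; apply: (@WordCongTrans _ _ _ (u' ++ v)).
  exact: (@word_congLR [::] u u' v Hu).
by have := @word_congLR u' v v' [::] Hv; rewrite !cats0.
Qed.

Definition word_eq : rel (seq A) := fun u v => `[< cong u v >].

Lemma word_eq_equiv : equiv_class_of word_eq.
Proof.
split=> [u|u v|v u w].
- by apply/asboolP; apply: WordCongRefl.
- by apply/asboolP/asboolP; apply: WordCongSym.
- by move=> /asboolP Huv /asboolP Hvw; apply/asboolP; apply: WordCongTrans Huv Hvw.
Qed.

Canonical word_eq_equiv_rel := EquivRelPack word_eq_equiv.

Definition presented : Type := {eq_quot word_eq_equiv_rel}%qT.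
HB.instance Definition _ := Choice.on presented.
HB.instance Definition _ := EqQuotient.on presented.

Definition class_of_word (w : seq A) : presented := \pi_presented%qT w.

Lemma class_of_wordP u v : class_of_word u = class_of_word v <-> cong u v.
Proof.
have P := @eqquotP _ _ presented u v.
by split=> [/P/asboolP|E] //; apply/P/asboolP.
Qed.

Lemma cong_repr w : cong (repr (class_of_word w)) w.
Proof. by apply/class_of_wordP; rewrite /class_of_word reprK. Qed.

Definition presented_mul (s t : presented) : presented :=
  class_of_word (repr s ++ repr t).
Definition presented_one : presented := class_of_word [::].

Lemma class_of_word_cat u v :
  presented_mul (class_of_word u) (class_of_word v) = class_of_word (u ++ v).
Proof.
by apply/class_of_wordP; apply: word_cong_cat; apply: cong_repr.
Qed.

Lemma class_of_word_surj s : exists w, s = class_of_word w.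
Proof. by exists (repr s); rewrite /class_of_word reprK. Qed.

Lemma presented_mulA : associative presented_mul.
Proof.
move=> s t r; have [u ->] := class_of_word_surj s.
have [v ->] := class_of_word_surj t; have [w ->] := class_of_word_surj r.
by rewrite !class_of_word_cat catA.
Qed.

Lemma presented_mul1 : left_id presented_one presented_mul.
Proof. by move=> s; have [u ->] := class_of_word_surj s; rewrite class_of_word_cat. Qed.

Lemma presented_1mul : right_id presented_one presented_mul.
Proof.
by move=> s; have [u ->] := class_of_word_surj s; rewrite class_of_word_cat cats0.
Qed.

HB.instance Definition _ :=
  isMonoid.Build presented presented_mulA presented_mul1 presented_1mul.

End PresentedMonoid.

(* The letter i : 'I_n stands for a_(i+1), so a_1 and a_n are the letters of  *)
(* value 0 and n.-1, and ordS is the successor modulo n. LC_braidl/r are      *)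
(* a_i a_(i+1) a_i = a_(i+1) a_i and a_(i+1) a_i a_(i+1) = a_(i+1) a_i for    *)
(* 1 <= i < n; LC_cyclel/r are a_n a_1 a_n = a_1 a_n and                      *)
(* a_1 a_n a_1 = a_1 a_n.                                                     *)
Inductive LC_rel (n : nat) : seq 'I_n -> seq 'I_n -> Prop :=
| LC_idem (i : 'I_n) : LC_rel [:: i; i] [:: i]
| LC_comm (i j : 'I_n) of (i.+1 < j)%N \/ (j.+1 < i)%N
    & (nat_of_ord i, nat_of_ord j) <> (0, n.-1)
    & (nat_of_ord i, nat_of_ord j) <> (n.-1, 0) :
    LC_rel [:: i; j] [:: j; i]
| LC_braidl (i j : 'I_n) of nat_of_ord j = i.+1 :
    LC_rel [:: i; j; i] [:: j; i]
| LC_braidr (i j : 'I_n) of nat_of_ord j = i.+1 :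
    LC_rel [:: j; i; j] [:: j; i]
| LC_cyclel (i j : 'I_n) of nat_of_ord i = n.-1 & nat_of_ord j = 0 :
    LC_rel [:: i; j; i] [:: j; i]
| LC_cycler (i j : 'I_n) of nat_of_ord i = n.-1 & nat_of_ord j = 0 :
    LC_rel [:: j; i; j] [:: j; i]
| LC_skip (i : 'I_n) :
    LC_rel [:: i; ordS i; ordS (ordS i)] [:: i; ordS (ordS i)].

Definition LC (n : nat) : Type := presented (@LC_rel n).

HB.instance Definition _ n := Monoid.on (LC n).
HB.instance Definition _ n := EqQuotient.on (LC n).
HB.instance Definition _ n := Countable.copy (LC n)
  (can_type (@reprK _ (LC n : quotType (seq 'I_n)))).

Section LCFinite.
Local Open Scope group_scope.
Variable n : nat.
Implicit Types (i j : 'I_n) (u v w x y : seq 'I_n).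

Local Notation cl w := (class_of_word (@LC_rel n) w : LC n).
Local Notation a i := (cl [:: i]).
Local Notation s := (@ordS n).
Local Notation p := (@ord_pred n).

Lemma LC_cat u v : cl (u ++ v) = cl u * cl v.
Proof. by rewrite -class_of_word_cat. Qed.

Lemma LC_cons i w : cl (i :: w) = a i * cl w.
Proof. exact: (LC_cat [:: i]). Qed.

Lemma LC_cat2 i j t : a i * (a j * t) = cl [:: i; j] * t.
Proof. by rewrite (LC_cons i [:: j]) mulgA. Qed.

Lemma LC_cat3 i j k t : a i * (a j * (a k * t)) = cl [:: i; j; k] * t.
Proof. by rewrite LC_cat2 mulgA -LC_cat. Qed.

Lemma LC_relP u v : LC_rel u v -> cl u = cl v.
Proof.
move=> Huv; apply/class_of_wordP.
by have := @WordCongRel _ _ [::] _ _ [::] Huv; rewrite /= !cats0.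
Qed.

Lemma val_ordS i : s i = (if i.+1 == n then 0 else i.+1) :> nat.
Proof.
rewrite /=; case: eqP => [->|ne]; first by rewrite modnn.
by rewrite modn_small //; have := ltn_ord i; lia.
Qed.

Lemma LC_idemt i t : a i * (a i * t) = a i * t.
Proof. by rewrite LC_cat2 (LC_relP (LC_idem i)). Qed.

Lemma LC_asc1 i t : a i * (a (s i) * (a i * t)) = a (s i) * (a i * t).
Proof.
rewrite LC_cat3 LC_cat2; congr (_ * t); apply: LC_relP.
have := val_ordS i; case: eqP => [E|_] E'; last exact: LC_braidl.
by apply: LC_cyclel => //; exact: (congr1 predn E).
Qed.

Lemma LC_asc2 i t : a (s i) * (a i * (a (s i) * t)) = a (s i) * (a i * t).
Proof.
rewrite LC_cat3 LC_cat2; congr (_ * t); apply: LC_relP.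
have := val_ordS i; case: eqP => [E|_] E'; last exact: LC_braidr.
by apply: LC_cycler => //; exact: (congr1 predn E).
Qed.

Lemma LC_skipt i t : a i * (a (s i) * (a (s (s i)) * t)) = a i * (a (s (s i)) * t).
Proof. by rewrite LC_cat3 LC_cat2 (LC_relP (LC_skip i)). Qed.

Lemma LC_comm_gen i j : j <> s i -> i <> s j -> a i * a j = a j * a i.
Proof.
have [->//|ij] := eqVneq i j.
move=> Hj Hi; rewrite -!LC_cat; apply: LC_relP.
have {}ij : nat_of_ord i <> j by move=> E; move/eqP: ij; apply; apply: val_inj.
have {}Hj : nat_of_ord j <> s i by move=> E; apply: Hj; apply: val_inj.
have {}Hi : nat_of_ord i <> s j by move=> E; apply: Hi; apply: val_inj.
move: Hi Hj; rewrite !val_ordS => Hi Hj.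
have := ltn_ord i; have := ltn_ord j.
move: Hi Hj; case: eqP => Ei; case: eqP => Ej Hi Hj li lj.
- by lia.
- by apply: LC_comm; [lia|case; lia|case; lia].
- by apply: LC_comm; [lia|case; lia|case; lia].
- by apply: LC_comm; [lia|case; lia|case; lia].
Qed.

Lemma LC_comm_word i w t :
  s i \notin w -> p i \notin w -> a i * (cl w * t) = cl w * (a i * t).
Proof.
elim: w t => [|j w IH] t; first by rewrite !mul1g.
rewrite !inE !negb_or => /andP[/eqP sj sw] /andP[/eqP pj pw].
rewrite (LC_cons j w) -!mulgA -IH // !mulgA (@LC_comm_gen i j) //.
  exact/nesym.
by move=> E; apply: pj; rewrite E ordSK.
Qed.

Lemma LC_gen_small i j : (n <= 2)%N -> a i = a j.
Proof.
move=> n2; have [->//|ij] := eqVneq i j.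
have {}ij : nat_of_ord i <> j by move=> E; move/eqP: ij; apply; apply: val_inj.
have si : s i = j.
  apply: ord_inj; rewrite val_ordS; have := ltn_ord i; have := ltn_ord j.
  by case: eqP; lia.
have sj : s j = i.
  apply: ord_inj; rewrite val_ordS; have := ltn_ord i; have := ltn_ord j.
  by case: eqP; lia.
have A := LC_asc1 i 1; have B := LC_asc1 j 1; have G := LC_asc2 i 1.
have C := LC_skipt i 1; have D := LC_skipt j 1.
have E := LC_idemt i 1; have F := LC_idemt j 1.
rewrite ?(si, sj) !mulg1 in A B C D E F G.
have Hi := etrans (esym E) (etrans (esym C) A).
have Hj := etrans (esym F) (etrans (esym D) B).
exact: (etrans Hi (etrans (esym G) (etrans B (esym Hj)))).
Qed.

Lemma ordS_neq i : (1 < n)%N -> s i <> i.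
Proof.
move=> n1 /(congr1 (@nat_of_ord n)); rewrite val_ordS.
by have := ltn_ord i; case: eqP; lia.
Qed.

Lemma ordSS_neq i : (2 < n)%N -> s (s i) <> i.
Proof.
move=> n2 /(congr1 (@nat_of_ord n)); rewrite !val_ordS.
by have := ltn_ord i; do !case: eqP; lia.
Qed.

Lemma ordSSS_neq i : (3 < n)%N -> s (s (s i)) <> i.
Proof.
move=> n3 /(congr1 (@nat_of_ord n)); rewrite !val_ordS.
by have := ltn_ord i; do !case: eqP; lia.
Qed.

Lemma LC_commSS i t : (3 < n)%N ->
  a i * (a (s (s i)) * t) = a (s (s i)) * (a i * t).
Proof.
move=> n3; rewrite !mulgA LC_comm_gen //.
  by move/ordS_inj; apply: ordS_neq; lia.
exact/nesym/ordSSS_neq.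
Qed.

Lemma LC_skip2 i t : (3 < n)%N ->
  a (s i) * (a i * (a (s (s i)) * t)) = a i * (a (s (s i)) * t).
Proof.
move=> n3; have := LC_skipt i (a i * t).
rewrite -LC_commSS // LC_asc1 => ->.
by rewrite LC_idemt.
Qed.

Lemma LC_skip3 i t : (3 < n)%N ->
  a i * (a (s (s i)) * (a (s i) * t)) = a i * (a (s (s i)) * t).
Proof.
move=> n3; have := congr1 (fun z => a (s (s i)) * z) (LC_skipt i t).
by rewrite /= -!LC_commSS // LC_asc2 LC_idemt.
Qed.

Lemma LC_step_small i w : (n <= 2)%N -> uniq w ->
  exists2 w', uniq w' & a i * cl w = cl w'.
Proof.
move=> n2; case: w => [|j w] Uw; first by exists [:: i]; rewrite // -LC_cons.
by exists (j :: w); rewrite // (LC_cons j w) (LC_gen_small i j n2) LC_idemt.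
Qed.

Lemma LC_mid u j v : cl (u ++ j :: v) = cl u * (a j * cl v).
Proof. by rewrite LC_cat (LC_cons j v). Qed.

Lemma uniq_mid u j v : uniq (u ++ j :: v) -> j \notin u ++ v.
Proof. by rewrite uniq_catC /= !mem_cat orbC => /andP[]. Qed.

(* Finiteness of LC n: every element is the class of a word without repeated  *)
(* letters. In a_i x a_i y with x avoiding i, one letter can be deleted; the  *)
(* lemmas below treat the positions of i+1 and i-1 in x.                      *)
Lemma LC_absorb0 i x y : s i \notin x -> p i \notin x ->
  a i * cl (x ++ i :: y) = cl (x ++ i :: y).
Proof. by move=> sx px; rewrite LC_mid LC_comm_word // LC_idemt. Qed.

Lemma LC_absorbS i x1 x2 y :
  s i \notin x1 ++ x2 -> p i \notin x1 ++ x2 ->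
  a i * cl ((x1 ++ s i :: x2) ++ i :: y) = cl ((x1 ++ s i :: x2) ++ i :: y).
Proof.
rewrite !mem_cat !negb_or => /andP[s1 s2] /andP[p1 p2].
by rewrite !LC_mid -!mulgA LC_comm_word // -(@LC_comm_word i x2) // LC_asc1.
Qed.

Lemma LC_absorbP i x1 x2 y :
  s i \notin x1 ++ x2 -> p i \notin x1 ++ x2 ->
  a i * cl ((x1 ++ p i :: x2) ++ i :: y) = cl (i :: (x1 ++ p i :: x2) ++ y).
Proof.
rewrite !mem_cat !negb_or => /andP[s1 s2] /andP[p1 p2].
rewrite (LC_cons i (_ ++ _)) (LC_cat (_ ++ _) y) !LC_mid -!mulgA.
rewrite !(@LC_comm_word i x1) // -(@LC_comm_word i x2) //.
by have := LC_asc2 (p i); rewrite ord_predK => ->.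
Qed.

Lemma LC_pskip i t : (3 < n)%N ->
  [/\ a i * (a (p i) * (a (s i) * t)) = a (p i) * (a (s i) * t),
      a (p i) * (a (s i) * (a i * t)) = a (p i) * (a (s i) * t)
    & a (p i) * (a (s i) * t) = a (s i) * (a (p i) * t)].
Proof.
move=> n3; have := LC_skip2 (p i) t n3; have := LC_skip3 (p i) t n3.
by have := LC_commSS (p i) t n3; rewrite ord_predK => -> -> ->.
Qed.

(* The word between the two neighbours avoids i, i+1 and i-1; whether the    *)
(* neighbours can be brought together depends on whether it contains i+2.    *)
Section BothNeighbours.
Variables (i : 'I_n) (x : seq 'I_n).
Hypotheses (n3 : (3 < n)%N) (ix : i \notin x) (sx : s i \notin x)
  (px : p i \notin x).

Lemma LC_absorbSP t : s (s i) \notin x ->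
  a i * (a (s i) * (cl x * (a (p i) * (a i * t)))) =
    a (s i) * (cl x * (a (p i) * t)).
Proof.
move=> ssx; have [E1 E2 E3] := LC_pskip i t n3; have [_ _ E4] := LC_pskip i (a i * t) n3.
rewrite !(@LC_comm_word (s i) x) ?ordSK // LC_comm_word //.
by rewrite -E4 E2 E1 E3.
Qed.

Lemma LC_absorbPS t : s (s i) \notin x ->
  a i * (a (p i) * (cl x * (a (s i) * (a i * t)))) =
    a (p i) * (cl x * (a (s i) * t)).
Proof.
move=> ssx; rewrite -!(@LC_comm_word (s i) x) ?ordSK // -(@LC_comm_word i x) //.
have [E1 E2 E3] := LC_pskip i (cl x * t) n3.
by rewrite E2 E1.
Qed.

End BothNeighbours.

Section BothNeighboursBlocked.
Variables (i : 'I_n) (x1 x2 : seq 'I_n).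
Let x := x1 ++ s (s i) :: x2.
Hypotheses (n3 : (3 < n)%N) (ux : uniq x) (ix : i \notin x)
  (sx : s i \notin x) (px : p i \notin x).

Lemma LC_absorbSP_blocked t :
  a i * (a (s i) * (cl x * (a (p i) * (a i * t)))) =
    a i * (cl x * (a (p i) * t)).
Proof.
have E : a i * (a (s i) * (cl x * (a (p i) * (a i * t)))) =
    a i * (cl x * (a (p i) * (a i * t))).
  have := uniq_mid ux; rewrite mem_cat => /norP[ss1 ss2].
  move: ix sx px; rewrite /x !mem_cat !in_cons !negb_or.
  move=> /and3P[i1 _ i2] /and3P[s1 _ s2] /and3P[p1 _ p2].
  rewrite LC_mid -!mulgA (@LC_comm_word (s i) x1) ?ordSK //.
  by rewrite !(@LC_comm_word i x1) // LC_skipt.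
rewrite E !(@LC_comm_word i x) //.
by have := LC_asc2 (p i) t; rewrite ord_predK => ->.
Qed.

Lemma LC_absorbPS_blocked t :
  a i * (a (p i) * (cl x * (a (s i) * (a i * t)))) =
    a (p i) * (cl x * (a (s i) * (a i * t))).
Proof.
have := uniq_mid ux; rewrite mem_cat => /norP[ss1 ss2].
move: ix sx px; rewrite /x !mem_cat !in_cons !negb_or.
move=> /and3P[i1 _ i2] /and3P[s1 _ s2] /and3P[p1 _ p2].
rewrite LC_mid -!mulgA -(@LC_comm_word (s i) x2) ?ordSK // -LC_asc1.
rewrite -(@LC_comm_word (s i) x1) ?ordSK //.
by have [-> _ _] := LC_pskip i (cl x1 * (a (s (s i)) * (a (s i) * (cl x2 * (a i * t))))) n3.
Qed.

End BothNeighboursBlocked.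

Lemma ordSSS3 i : n = 3 -> s (s i) = p i.
Proof.
move=> n3; apply: (can_inj (@ordSK n)); rewrite ord_predK; apply: ord_inj.
by rewrite !val_ordS; have := ltn_ord i; do !case: eqP; lia.
Qed.

Lemma ord3_cover i j : n = 3 -> [|| j == i, j == s i | j == p i].
Proof.
move=> n3; rewrite -ordSSS3 // -!(inj_eq (@ord_inj n)) !val_ordS.
have := ltn_ord i; have := ltn_ord j; do !case: eqP; lia.
Qed.

Lemma nil3 i w : n = 3 -> i \notin w -> s i \notin w -> p i \notin w -> w = [::].
Proof.
move=> n3; case: w => // j w; rewrite !inE !negb_or.
by have := ord3_cover i j n3; do !case: eqVneq => // _.
Qed.

Lemma LC_absorbSP3 i : n = 3 ->
  a i * cl [:: s i; p i; i] = cl [:: i; p i].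
Proof.
move=> n3; rewrite (LC_cons (s i) [:: p i; i]) (LC_cons (p i) [:: i]).
rewrite (LC_cons i [:: p i]) -!(ordSSS3 i n3) LC_skipt; have := LC_asc2 (p i) 1.
by rewrite ord_predK (ordSSS3 i n3) !mulg1.
Qed.

Lemma LC_absorbPS3 i : n = 3 ->
  a i * cl [:: p i; s i; i] = cl [:: s i; i].
Proof.
move=> n3; have si3 : s (p i) = i := ord_predK i.
have E t : a i * (a (p i) * t) = a (s i) * (a i * t).
  have A := LC_skipt i (a i * t); have B := LC_skipt (s i) t.
  rewrite (ordSSS3 i n3) si3 in A B.
  have C := LC_asc2 (p i) t; rewrite si3 in C.
  by rewrite -C -A B LC_asc1.
have := LC_idemt i 1; rewrite !mulg1 => ii.
by rewrite (LC_cons (p i) [:: s i; i]) (LC_cons (s i) [:: i]) E LC_asc2 ii.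
Qed.

Lemma subseq_drop1 (u v : seq 'I_n) j : subseq (u ++ v) (u ++ j :: v).
Proof. by rewrite cat_subseq ?subseq_cons. Qed.

Lemma LC_step_both i x1 x2 x3 y j k : (2 < n)%N ->
  (j, k) = (s i, p i) \/ (j, k) = (p i, s i) ->
  uniq (x1 ++ j :: x2 ++ k :: x3 ++ i :: y) ->
  exists2 w', uniq w' &
    a i * cl (x1 ++ j :: x2 ++ k :: x3 ++ i :: y) = cl w'.
Proof.
move=> n2 Hjk U; have := uniq_mid U.
have E1 : x1 ++ j :: x2 ++ k :: x3 ++ i :: y =
  (x1 ++ j :: x2) ++ k :: x3 ++ i :: y by rewrite -catA.
have E2 : x1 ++ j :: x2 ++ k :: x3 ++ i :: y =
  (x1 ++ j :: x2 ++ k :: x3) ++ i :: y by rewrite -catA /= -catA.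
have := U; rewrite E1 => /uniq_mid; have := U; rewrite E2 => Ui.
have Uxy := subseq_uniq (subseq_drop1 _ _ _) Ui.
have Uixy : uniq (i :: (x1 ++ j :: x2 ++ k :: x3) ++ y) by rewrite /= uniq_mid.
have Ux2 : uniq x2.
  by move: U; rewrite cat_uniq /= cat_uniq => /and3P[_ _ /and3P[_ ? _]].
move/uniq_mid: Ui.
rewrite !(mem_cat, inE) !negb_or.
move=> /andP[/and5P[i1 _ i2 _ i3] iy].
move=> /and4P[/and3P[k1 _ k2] k3 _ ky].
move=> /and5P[j1 j2 _ j3 /andP[_ jy]].
have [n3|n3] := eqVneq n 3.
  have nilT z : i \notin z -> j \notin z -> k \notin z -> z = [::].
    by case: Hjk => [][-> ->] *; apply: (@nil3 i).
  have -> : x1 = [::] by apply: nilT.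
  have -> : x2 = [::] by apply: nilT.
  have -> : x3 = [::] by apply: nilT.
  have -> : y = [::] by apply: nilT.
  have si := @ordS_neq i (ltnW n2).
  have pi : p i != i by apply/eqP => E; apply: si; rewrite -{1}E ord_predK.
  case: Hjk => [][-> ->].
    exists [:: i; p i]; last exact: LC_absorbSP3.
    by rewrite /= inE eq_sym pi.
  exists [:: s i; i]; last exact: LC_absorbPS3.
  by rewrite /= inE andbT; apply/eqP.
have {n2}n3 : (3 < n)%N by rewrite ltn_neqAle eq_sym n3.
have Ux : uniq ((x1 ++ j :: x2 ++ k :: x3) ++ y) by case/andP: Uixy.
have [ss|ss] := boolP (s (s i) \in x2); last first.
  exists ((x1 ++ j :: x2 ++ k :: x3) ++ y) => //.
  rewrite (LC_cat (x1 ++ _) y) !LC_mid -!mulgA.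
  case: Hjk => [][Ej Ek]; subst j k.
    rewrite (@LC_comm_word i x1) // -(@LC_comm_word i x3) //.
    by rewrite LC_absorbSP.
  rewrite (@LC_comm_word i x1) // -(@LC_comm_word i x3) //.
  by rewrite LC_absorbPS.
case/splitPr: ss Ux2 i2 j2 k2 Ux Uixy U => z1 z2 Ux2 i2 j2 k2 Ux Uixy U.
set z := z1 ++ _ in Ux2 i2 j2 k2 Ux Uixy U *.
case: Hjk => [][Ej Ek]; subst j k.
  exists (i :: (x1 ++ z ++ p i :: x3) ++ y).
    apply: subseq_uniq Uixy.
    have S := subseq_drop1 x1 (z ++ p i :: x3) (s i).
    exact: (cat_subseq (cat_subseq (subseq_refl [:: i]) S) (subseq_refl y)).
  rewrite (LC_cons i (_ ++ y)) (LC_cat (x1 ++ _) y) (LC_cat x1) !(LC_mid _ (p i)).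
  rewrite (LC_mid _ (s i)) (LC_mid _ i) -!mulgA.
  rewrite !(@LC_comm_word i x1) // -(@LC_comm_word i x3) //.
  by rewrite LC_absorbSP_blocked.
exists (x1 ++ p i :: z ++ s i :: x3 ++ i :: y).
  by move: U; rewrite -catA.
rewrite !(LC_mid _ (s i)) !(LC_mid _ (p i)) ?(LC_mid _ (s i)) !(LC_mid _ i).
rewrite -!mulgA.
rewrite !(@LC_comm_word i x1) // -(@LC_comm_word i x3) //.
by rewrite LC_absorbPS_blocked.
Qed.

Lemma LC_step i w : uniq w -> exists2 w', uniq w' & a i * cl w = cl w'.
Proof.
have [n2|n2] := leqP n 2; first exact: LC_step_small.
have [|iw Uw] := boolP (i \in w); last first.
  by exists (i :: w); [rewrite cons_uniq iw|rewrite (LC_cons i w)].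
case/splitPr=> x y Uxy.
have := uniq_mid Uxy; rewrite mem_cat => /norP[ix iy].
have Uixy : uniq (i :: x ++ y).
  rewrite /= mem_cat negb_or ix iy /=.
  exact: subseq_uniq (subseq_drop1 x y i) Uxy.
have := Uxy; rewrite cat_uniq => /and3P[Ux _ _].
have [sx|sx] := boolP (s i \in x); have [px|px] := boolP (p i \in x).
- have sp : s i != p i.
    by apply/eqP => /(congr1 s); rewrite ord_predK; exact: ordSS_neq.
  case/splitPr: sx px Uxy {ix Uixy Ux} => x1 x2.
  rewrite mem_cat in_cons eq_sym (negbTE sp) /= => /orP[] px.
    case/splitPr: px => x0 x1'; rewrite -!catA /= => Uxy.
    by apply: LC_step_both => //; right.
  case/splitPr: px => x0 x3; rewrite -!catA /= -!catA /= => Uxy.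
  by apply: LC_step_both => //; left.
- case/splitPr: sx px ix Ux Uxy Uixy => x1 x2 px ix Ux Uxy Uixy.
  have := uniq_mid Ux => s12.
  move: px; rewrite mem_cat in_cons !negb_or => /and3P[p1 _ p2].
  exists ((x1 ++ s i :: x2) ++ i :: y) => //.
  by apply: LC_absorbS; rewrite // mem_cat negb_or p1.
- case/splitPr: px sx ix Ux Uxy Uixy => x1 x2 sx ix Ux Uxy Uixy.
  have := uniq_mid Ux => p12.
  move: sx; rewrite mem_cat in_cons !negb_or => /and3P[s1 _ s2].
  exists (i :: (x1 ++ p i :: x2) ++ y) => //.
  by apply: LC_absorbP; rewrite // mem_cat negb_or s1.
- by exists (x ++ i :: y) => //; apply: LC_absorb0.
Qed.

Lemma LC_uniq_word (z : LC n) : exists2 w, uniq w & z = cl w.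
Proof.
have [u ->] := class_of_word_surj z.
elim: u => [|i u [w Uw E]]; first by exists [::].
have [w' Uw' E'] := LC_step i Uw.
by exists w'; rewrite // (LC_cons i u) E.
Qed.

Definition LC_elts : seq (LC n) :=
  undup [seq cl (val w) | w : n.-bseq 'I_n].

Lemma LC_eltsP : Finite.axiom LC_elts.
Proof.
apply: Finite.uniq_enumP (undup_uniq _) _ => z; rewrite mem_undup.
have [w Uw ->] := LC_uniq_word z.
have w_n : (size w <= n)%N.
  by rewrite -[n in (_ <= n)%N]card_ord -(card_uniqP Uw) max_card.
by apply/imageP; exists (Bseq w_n).
Qed.

End LCFinite.

HB.instance Definition _ n := isFinite.Build (LC n) (@LC_eltsP n).

(* Main.v *)
Require Import Defs.
From mathcomp Require Import all_boot all_algebra.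
From mathcomp Require Import reals complex mpoly.
From mathcomp Require Import boolp zify.

(* In the algebra of LC_n let e(i) = a_i a_(i+1) - a_(i+1) a_i, with cyclic   *)
(* indices.  For n > 4 it is fixed by left multiplication by a_i, annihilated *)
(* by a_(i-2), a_(i-1), a_(i+1), a_(i+2), a_(i+3), and commutes with the      *)
(* other generators.  So e(1) e(5) can only be nonzero if n >= 8.             *)
(*                                                                            *)
(* If n >= 8, let v = e(1) (1 - a_6) (1 - a_7) ... (1 - a_(n-2)) a_5.  Then v *)
(* and v a_6 span a two-dimensional left ideal on which every a_j acts by a   *)
(* scalar (1 for j = 1, 5 and 0 otherwise).  Every linear functional kills a  *)
(* nonzero element of it, hence the left ideal this element generates, so the *)
(* bilinear form (s, t) |-> x_st is degenerate.                               *)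
(*                                                                            *)
(* If n < 8, some 0/1 specialization of the variables has odd determinant.    *)
(* Normal forms of the elements come from a Knuth-Bendix completion computed  *)
(* inside the logic: completed rules are consequences of the relations, and   *)
(* distinct normal forms are distinct elements because left multiplication on *)
(* normal forms is checked to satisfy the relations.                          *)

Set Implicit Arguments.
Unset Strict Implicit.
Unset Printing Implicit Defensive.

Import GRing.Theory Num.Theory.

(** * Specializations of the semigroup determinant *)

(** The determinant is nonzero exactly when some linear functional on the algebra of LC_n gives a
    nondegenerate bilinear form, that is, when this algebra is Frobenius. [semigroup_det_neq0]
    proves this from one specialization that is invertible modulo 2. For n < 8, [LC_certified]
    computes such a specialization on normal forms, and [certificate_det] carries it over to the
    monoid. [cayley_mx_det0] refutes it from two independent vectors on which every element acts by
    the same scalar. For n >= 8, [socle_eltP] gives the scalars and [phi_socle_elt] the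
    independence; [LC_cayley_det0] combines them. *)

Section Determinant.
Local Open Scope ring_scope.
Variable S : finSemigroupType.

Definition cayley_mx (R : Type) (f : S -> R) : 'M[R]_#|S| :=
  \matrix_(i, j) f (enum_val i * enum_val j)%g.

(** A 0/1 specialization has an integer determinant, whose reduction modulo 2 is that of
    [cayley_mx f] over [bool], the field with two elements; there [g] is an inverse. An odd integer
    is nonzero in characteristic 0. *)
Lemma semigroup_det_neq0 (K : numFieldType) (f : S -> bool)
    (g : S -> S -> bool) :
  (forall s t, \sum_(u : S) f (s * u)%g * g u t = (s == t)) ->
  semigroup_det K S != 0.
Proof.
move=> fg; pose z (s : S) : int := f s.
apply/eqP => /(congr1 (meval (fun i => (z (enum_val i))%:~R : K))).
rewrite meval0 /semigroup_det -det_map_mx.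
have -> : map_mx (meval (fun i => (z (enum_val i))%:~R : K))
    (\matrix_(i, j) 'X_(enum_rank (enum_val i * enum_val j)%g)) =
    map_mx intr (cayley_mx z).
  by apply/matrixP => i j; rewrite !mxE mevalXU enum_rankK.
rewrite det_map_mx => /eqP; rewrite intr_eq0 => /eqP.
move/(congr1 (intr : int -> bool)); rewrite -det_map_mx.
have -> : map_mx intr (cayley_mx z) = cayley_mx f.
  by apply/matrixP => i j; rewrite !mxE /z; case: (f _).
have fg1 : cayley_mx f *m \matrix_(i, j) g (enum_val i) (enum_val j) = 1%:M.
  apply/matrixP => i j; rewrite !mxE -(inj_eq enum_val_inj).
  have -> (b : bool) : (b : nat)%:R = b :> bool by case: b.
  rewrite -fg [RHS](reindex _ (onW_bij _ (@enum_val_bij S))) /=.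
  by apply: eq_bigr => k _; rewrite !mxE.
have := congr1 determinant fg1; rewrite det_mulmx det1 => /[swap] ->.
by rewrite mul0r.
Qed.

End Determinant.

(** * The left regular representation and degenerate forms *)

Section Regular.
Local Open Scope ring_scope.
Variables (P : idomainType) (S : finSemigroupType).
Implicit Types (f : S -> P) (s t : S) (y : 'cV[P]_#|S|).

Definition regular_mx s : 'M[P]_#|S| :=
  \matrix_(i, j) (enum_val i == s * enum_val j)%g%:R.
Definition functional f : 'rV[P]_#|S| := \row_j f (enum_val j).
Definition point t : 'cV[P]_#|S| := \col_i (enum_val i == t)%:R.

Lemma functional_regular f s :
  functional f *m regular_mx s = functional (fun t => f (s * t)%g).
Proof.
apply/rowP => j; rewrite !mxE (bigD1 (enum_rank (s * enum_val j)%g)) //=.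
rewrite !mxE enum_rankK eqxx mulr1 big1 ?addr0 // => k ne_k.
by rewrite !mxE -(inj_eq enum_rank_inj) enum_valK (negbTE ne_k) mulr0.
Qed.

Lemma functional_point f t : functional f *m point t = (f t)%:M.
Proof.
apply/matrixP => i j; rewrite !ord1 !mxE (bigD1 (enum_rank t)) //=.
rewrite !mxE enum_rankK !eqxx mulr1 big1 ?addr0 // => k ne_k.
by rewrite !mxE -(inj_eq enum_rank_inj) enum_valK (negbTE ne_k) mulr0.
Qed.

Lemma regular_mxM s t : regular_mx (s * t)%g = regular_mx s *m regular_mx t.
Proof.
apply/row_matrixP => i; rewrite row_mul.
have rowE u :
    row i (regular_mx u) = functional (fun t => (enum_val i == u * t)%g%:R).
  by apply/rowP => j; rewrite !mxE.
by rewrite !rowE functional_regular; apply/rowP => j; rewrite !mxE mulgA.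
Qed.

(* Some nonzero combination y of y1 and y2 is killed by f, hence so is S y, *)
(* and y lies in the kernel of the Cayley matrix.                           *)
Lemma cayley_mx_det0 f y1 y2 :
  (forall s, exists c,
     regular_mx s *m y1 = c *: y1 /\ regular_mx s *m y2 = c *: y2) ->
  (forall b c, b *: y1 + c *: y2 = 0 -> b = 0 /\ c = 0) ->
  \det (cayley_mx f) = 0.
Proof.
move=> eig indep; apply/eqP; apply: contraT => det_neq0.
have ker b c : functional f *m (b *: y1 + c *: y2) = 0 -> b = 0 /\ c = 0.
  move=> fy0; apply: indep; set y := _ + _ in fy0 *.
  have My0 : cayley_mx f *m y = 0.
    apply/row_matrixP => i; rewrite row_mul row0.
    have -> : row i (cayley_mx f) = functional f *m regular_mx (enum_val i).
      by rewrite functional_regular; apply/rowP => j; rewrite !mxE.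
    have [d [E1 E2]] := eig (enum_val i).
    rewrite -mulmxA {1}/y mulmxDr -!scalemxAr E1 E2.
    rewrite !scalerA (mulrC b) (mulrC c) -!scalerA -scalerDr.
    by rewrite -/y -scalemxAr fy0 scaler0.
  (* The adjugate gives injectivity over the integral domain [P] without passing to fractions. *)
  have := congr1 (mulmx (\adj (cayley_mx f))) My0.
  rewrite mulmx0 mulmxA mul_adj_mx mul_scalar_mx => /colP dy0.
  apply/colP => i; have := dy0 i; rewrite !mxE => /eqP.
  by rewrite mulf_eq0 (negbTE det_neq0) => /eqP.
pose z y := (functional f *m y) 0 0.
have zE y : functional f *m y = (z y)%:M.
  by apply/matrixP => i j; rewrite !ord1 [RHS]mxE eqxx.
(* The combination [z y2 *: y1 - z y1 *: y2] is killed by [f], so both coefficients vanish; but then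
   [y1] itself is killed, with coefficients 1 and 0. *)
have [z2 z1] : z y2 = 0 /\ - z y1 = 0.
  apply: ker; rewrite mulmxDr -!scalemxAr !zE; apply/matrixP => i j.
  by rewrite !ord1 !mxE eqxx mulrC mulNr subrr.
have [] := ker 1 0; last by move=> /eqP; rewrite oner_eq0.
rewrite scale0r addr0 scale1r zE; move/eqP: z1; rewrite oppr_eq0 => /eqP->.
by apply/matrixP => i j; rewrite !mxE mul0rn.
Qed.

End Regular.

(** * Knuth-Bendix completion *)

Definition equation := (seq nat * seq nat)%type.

(* If w is in normal form for the rewriting rules rs, this normalizes x :: w. *)
(* The bound k on the number of rewriting steps affects termination only; the *)
(* default rule ([::], [::]) is a no-op, selected when no rule applies.       *)
Fixpoint push (rs : seq equation) (k x : nat) (w : seq nat) : seq nat :=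
  if k is k'.+1 then
    let: (l, r) :=
      nth ([::], [::]) rs (find (fun e => prefix e.1 (x :: w)) rs) in
    foldr (push rs k') (drop (size l) (x :: w)) r
  else x :: w.

Definition normalize rs w := foldr (push rs 10) [::] w.

Fixpoint shortlex_lt (u v : seq nat) :=
  match u, v with
  | x :: u', y :: v' => (size u < size v) ||
      (size u == size v) && ((x < y) || (x == y) && shortlex_lt u' v')
  | _, _ => size u < size v
  end.

Definition add_equation rs (e : equation) :=
  let u := normalize rs e.1 in let v := normalize rs e.2 in
  if u == v then rs
  else rcons rs (if shortlex_lt u v then (v, u) else (u, v)).

(** Critical pairs: the word [take k e.1 ++ f.1] begins with [e.1], and the two sides are its
    reductions by [e] and by [f]. The range of [k] makes the overlap nonempty and proper in
    [e.1]. *)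
Definition overlaps (e f : equation) : seq equation :=
  [seq (e.2 ++ drop (size e.1 - k) f.1, take k e.1 ++ f.2)
     | k <- iota 1 (size e.1).-1 & prefix (drop k e.1) f.1].

(** Restarting from no rules reduces the old rules as well; inserting short equations first lets
    them simplify longer ones. *)
Definition complete_step rs :=
  foldl add_equation [::]
    (sort (relpre (fun e : equation => size e.1 + size e.2) leq)
       (rs ++ flatten [seq overlaps e f | e <- rs, f <- rs])).

Definition LC_equations n : seq equation :=
  let s i := i.+1 %% n in
  [seq ([:: i; j], [:: j; i]) |
     i <- iota 0 n, j <- [seq j <- iota 0 n | (j != s i) && (i != s j)]] ++
  flatten [seq [:: ([:: i; i], [:: i]);
                   ([:: i; s i; i], [:: s i; i]);
                   ([:: s i; i; s i], [:: s i; i]);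
                   ([:: i; s i; s (s i)], [:: i; s (s i)])] | i <- iota 0 n].

Section Completion.
Variables (T : monoidType) (a : nat -> T).
Local Open Scope group_scope.

Definition eval_word (w : seq nat) : T := foldr (fun i t => a i * t) 1 w.
Definition sound (rs : seq equation) :=
  forall e, e \in rs -> eval_word e.1 = eval_word e.2.

Lemma eval_word_cat u v : eval_word (u ++ v) = eval_word u * eval_word v.
Proof. by elim: u => [|i u IH] /=; rewrite ?mul1g // IH mulgA. Qed.

Section Rules.
Variable rs : seq equation.
Hypothesis rs_sound : sound rs.

Lemma eval_word_push k x w : eval_word (push rs k x w) = a x * eval_word w.
Proof.
elim: k x w => //= k IH x w; set P := fun e : equation => _.
case E: nth => [l r].
have [pl lr] : prefix l (x :: w) /\ eval_word l = eval_word r.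
  have [hasP|/hasPn noP] := boolP (has P rs).
    have := nth_find ([::], [::]) hasP; rewrite E; split=> //.
    by rewrite (rs_sound (e := (l, r))) // -E mem_nth // -has_find.
  move: E; rewrite nth_default; first by case=> <- <-.
  by rewrite leqNgt -has_find; exact/hasPn.
have foldrE v : eval_word (foldr (push rs k) v r) = eval_word r * eval_word v.
  by elim: r {E lr} => [|i r IHr] /=; rewrite ?mul1g // IH IHr mulgA.
rewrite foldrE -lr -eval_word_cat -[RHS]/(eval_word (x :: w)).
by case/prefixP: pl => v ->; rewrite drop_size_cat.
Qed.

Lemma eval_word_foldr_push k u v :
  eval_word (foldr (push rs k) v u) = eval_word u * eval_word v.
Proof.
by elim: u => [|i u IH] /=; rewrite ?mul1g // eval_word_push IH mulgA.
Qed.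

Lemma add_equation_sound e :
  eval_word e.1 = eval_word e.2 -> sound (add_equation rs e).
Proof.
move=> Ee; have nfE w : eval_word (normalize rs w) = eval_word w.
  by rewrite eval_word_foldr_push /= mulg1.
rewrite /add_equation; case: ifP => // _ f.
rewrite mem_rcons inE => /predU1P[->|/rs_sound //].
by case: ifP => _ /=; rewrite !nfE.
Qed.

Lemma overlaps_sound e f : e \in rs -> f \in rs ->
  forall c, c \in overlaps e f -> eval_word c.1 = eval_word c.2.
Proof.
move=> /rs_sound Ee /rs_sound Ef c /mapP[k]; rewrite mem_filter => /andP[].
case/prefixP=> w fE _ -> /=; rewrite !eval_word_cat -Ee -Ef fE -size_drop.
rewrite drop_size_cat // eval_word_cat mulgA -[in RHS]eval_word_cat.
by rewrite cat_take_drop.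
Qed.

End Rules.

Lemma complete_step_sound rs : sound rs -> sound (complete_step rs).
Proof.
move=> rsP; rewrite /complete_step; set s := sort _ _.
have : forall e, e \in s -> eval_word e.1 = eval_word e.2.
  move=> e; rewrite mem_sort mem_cat => /orP[/rsP //|].
  case/flattenP=> c /allpairsP[[e1 e2] /= [e1P e2P ->]].
  exact: (overlaps_sound rsP e1P e2P).
have : sound [::] by [].
elim: s [::] => //= e s IH rs' rs'P sP; apply: IH => [|f fs].
  by apply: add_equation_sound => //; apply: sP; rewrite mem_head.
by apply: sP; rewrite inE fs orbT.
Qed.

End Completion.

Section Cyclic.
Variable n : nat.
Local Notation lc w := (class_of_word (@LC_rel n.+1) (map inord w) : LC n.+1).

Lemma eval_generators (w : seq nat) :
  eval_word (fun i => lc [:: i]) w = lc w.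
Proof. by elim: w => //= i w ->; rewrite -(@LC_cons n.+1). Qed.

Lemma LC_equations_sound :
  sound (fun i => lc [:: i]) (LC_equations n.+1).
Proof.
have sE i : i < n.+1 -> inord (i.+1 %% n.+1) = ordS (inord i : 'I_n.+1).
  by move=> lt_i; apply: val_inj; rewrite /= !inordK ?ltn_pmod.
move=> e; rewrite mem_cat => /orP[/allpairsPdep[i [j []]]|/flattenP[c cP]].
  rewrite mem_filter !mem_iota /= add0n => lt_i /andP[/andP[nj ni] lt_j] ->.
  rewrite !eval_generators /= !(LC_cat [:: _] [:: _]); apply: LC_comm_gen.
    by move/(congr1 val)/eqP; rewrite /= !inordK // (negbTE nj).
  by move/(congr1 val)/eqP; rewrite /= !inordK // (negbTE ni).
have [i + ->] := mapP cP; rewrite mem_iota /= add0n => lt_i.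
have lt_s : i.+1 %% n.+1 < n.+1 by rewrite ltn_pmod.
rewrite !inE => /or4P[] /eqP-> /=.
- exact: LC_idemt.
- rewrite sE //; exact: LC_asc1.
- rewrite sE //; exact: LC_asc2.
- rewrite !sE //; exact: LC_skipt.
Qed.

End Cyclic.

(** * Determinants for fewer than 8 generators *)

(* Gauss-Jordan elimination over the field with two elements, discarding each *)
(* column once it is cleared.  The inverse it computes is checked below, so   *)
(* the algorithm itself needs no specification.                               *)
Definition eliminate (rs : seq bitseq * seq bitseq) : seq bitseq * seq bitseq :=
  let: (done, todo) := rs in
  let i := find (head false) todo in
  let p := behead (nth [::] todo i) in
  let clear r := if head false r then [seq c.1 (+) c.2 | c <- zip (behead r) p]
                 else behead r in
  (rcons (map clear done) p, map clear (take i todo ++ drop i.+1 todo)).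

Definition inverse_bits (M : seq bitseq) : seq bitseq :=
  let N := size M in
  (iter N eliminate
     ([::],
      [seq nth [::] M i ++ [seq i == j | j <- iota 0 N] | i <- iota 0 N])).1.

Definition transpose_bits (M : seq bitseq) : seq bitseq :=
  [seq [seq nth false r j | r <- M] | j <- iota 0 (size M)].

(** [n] rounds are expected to suffice, since every element has a word without repeated letters;
    [certificate] checks closure in any case. *)
Definition normal_words n (rs : seq equation) : seq (seq nat) :=
  iter n (fun W => undup (W ++ [seq push rs 10 i w | i <- iota 0 n, w <- W]))
    [:: [::]].

(* A normal word is encoded by its position j in W, and D by the positions of *)
(* its left multiples: act D i j stands for the product of a_(i+1) by j.      *)
Definition transitions n rs (W : seq (seq nat)) : seq (seq nat) :=
  [seq [seq index (push rs 10 i w) W | w <- W] | i <- iota 0 n].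

Definition act (D : seq (seq nat)) i j := nth 0 (nth [::] D i) j.

(* The elements whose variable is specialized to 1: the rotations of a few *)
(* representatives, found by search for each n.                            *)
Definition LC_support n D : seq nat :=
  let reps := nth [::]
   [:: [::]; [:: [:: 0]]; [:: [:: 0]]; [:: [:: 0; 2]];
    [:: [:: 0; 1]; [:: 0; 2]];
    [:: [:: 0]; [:: 0; 1]; [:: 0; 1; 3]];
    [:: [::]; [:: 0; 5]; [:: 0; 2; 4]];
    [:: [:: 0; 2]; [:: 0; 3]; [:: 0; 1; 4]; [:: 0; 1; 3; 5]]] n in
  [seq foldr (act D) 0 [seq (x + k) %% n | x <- w] | w <- reps, k <- iota 0 n].

Definition gram D W (L : seq nat) : seq bitseq :=
  [seq [seq foldr (act D) k w \in L | k <- iota 0 (size W)] | w <- W].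

(** The nonempty default in the first test also forces [W] to be nonempty. Row [j] of [C] is column
    [j] of the inverse of [M], so the last test pairs rows with rows. *)
Definition certificate n (W D : seq (seq nat)) (L : seq nat) :=
  let N := size W in
  let M := gram D W L in
  let C := inverse_bits (transpose_bits M) in
  [&& nth [:: 0] W 0 == [::],
      all (all (gtn n)) W,
      all (fun j => foldr (act D) 0 (nth [::] W j) == j) (iota 0 N),
      all (fun i => all (fun j => act D i j < N) (iota 0 N)) (iota 0 n),
      all (fun e => all (fun j =>
        foldr (act D) j e.1 == foldr (act D) j e.2) (iota 0 N))
        (LC_equations n),
      all (fun c => size c == N) C, size C == N &
      all (fun i => all (fun j =>
        foldr addb false
          [seq b.1 && b.2 | b <- zip (nth [::] M i) (nth [::] C j)]
          == (i == j)) (iota 0 N)) (iota 0 N)].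

Definition LC_certificate n :=
  let rs := iter 2 complete_step (LC_equations n) in
  let W := normal_words n rs in
  let D := transitions n rs W in
  certificate n W D (LC_support n D).

(** Thanks to this, a table that satisfies [LC_equations] defines an action of LC_n;
    [LC_equations_sound] is the other direction, needed for rewriting. *)
Lemma LC_rel_equation n (u v : seq 'I_n) : LC_rel u v ->
  (map val u, map val v) \in LC_equations n.
Proof.
have S (i : 'I_n) : (val i).+1 %% n = ordS i by [].
have single (i : 'I_n) e : e \in
    [:: ([:: val i; val i], [:: val i]);
       ([:: val i; val (ordS i); val i], [:: val (ordS i); val i]);
       ([:: val (ordS i); val i; val (ordS i)], [:: val (ordS i); val i]);
       ([:: val i; val (ordS i); val (ordS (ordS i))],
        [:: val i; val (ordS (ordS i))])] -> e \in LC_equations n.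
  move=> eP; rewrite mem_cat; apply/orP; right; apply/flattenP.
  eexists; [apply: map_f; rewrite mem_iota; exact: ltn_ord | exact: eP].
have succ (i j : 'I_n) :
    j = (if i.+1 == n then 0 else i.+1) :> nat -> j = ordS i.
  by move=> E; apply: ord_inj; rewrite E val_ordS.
case=> [i|i j ij ij1 ij2|i j ij|i j ij|i j i_max j0|i j i_max j0|i].
- by apply: (single i); rewrite mem_head.
- rewrite mem_cat; apply/orP; left; apply/allpairsPdep; exists (val i), (val j).
  split=> //; first by rewrite mem_iota ltn_ord.
  rewrite mem_filter mem_iota /= add0n ltn_ord andbT !S !val_ordS.
  have := ltn_ord i; have := ltn_ord j.
  have {}ij1 : i = 0 :> nat -> j <> n.-1 :> nat.
    by move=> E E1; apply: ij1; rewrite E E1.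
  have {}ij2 : j = 0 :> nat -> i <> n.-1 :> nat.
    by move=> E E1; apply: ij2; rewrite E E1.
  case: (i.+1 =P n); case: (j.+1 =P n) => /= *;
    by apply/andP; split; apply/eqP; lia.
- rewrite (succ i j); last by have := ltn_ord j; case: eqP; lia.
  by apply: (single i); rewrite !inE !eqxx ?orbT.
- rewrite (succ i j); last by have := ltn_ord j; case: eqP; lia.
  by apply: (single i); rewrite !inE !eqxx ?orbT.
- rewrite (succ i j); last by have := ltn_ord i; case: eqP; lia.
  by apply: (single i); rewrite !inE !eqxx ?orbT.
- rewrite (succ i j); last by have := ltn_ord i; case: eqP; lia.
  by apply: (single i); rewrite !inE !eqxx ?orbT.
- by apply: (single i); rewrite !inE !eqxx ?orbT.
Qed.

(** * From a certificate to the determinant *)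

Section Certificate.
Variables (m : nat) (W D : seq (seq nat)) (L : seq nat).
Let n := m.+1.
Let N := size W.
Hypothesis certified : certificate n W D L.
Hypothesis transition : forall i j, i < n -> j < N ->
  class_of_word (@LC_rel n) (map inord (nth [::] W (act D i j))) =
  class_of_word (@LC_rel n) (inord i :: map inord (nth [::] W j)).
Local Notation cl w := (class_of_word (@LC_rel n) w : LC n).

Definition run (u : seq 'I_n) j := foldr (act D) j (map val u).

Lemma act_lt i j : i < n -> j < N -> act D i j < N.
Proof.
case/and5P: certified => _ _ _ /allP H _ ii jj.
by apply: (allP (H i _)); rewrite mem_iota.
Qed.

Lemma run_lt u j : j < N -> run u j < N.
Proof. by move=> jN; elim: u => //= i u; apply: act_lt; exact: ltn_ord. Qed.

Lemma run_cong u v j : word_cong (@LC_rel n) u v -> j < N -> run u j = run v j.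
Proof.
case/and5P: certified => _ _ _ _ /andP[/allP H _] uv.
elim: uv j => {u v}
  [//|u v _ IH j /IH //|u v w _ IH1 _ IH2 j jN|x u v y uv j jN].
  by rewrite IH1 // IH2.
rewrite /run !map_cat !foldr_cat -!/(run _ _); congr (foldr _ _ _).
apply/eqP; apply: (allP (H _ (LC_rel_equation uv))).
by rewrite mem_iota; exact: run_lt.
Qed.

Definition state (s : LC n) := run (repr s) 0.
Definition word j : seq 'I_n := map inord (nth [::] W j).

Lemma size_gt0 : 0 < N.
Proof. by case/andP: certified; rewrite /N; case: W. Qed.

Lemma stateE u : state (cl u) = run u 0.
Proof. by apply: run_cong size_gt0; exact: cong_repr. Qed.

Lemma state_lt s : state s < N.
Proof. exact/run_lt/size_gt0. Qed.

Lemma run_word j k : j < N -> run (word j) k = foldr (act D) k (nth [::] W j).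
Proof.
case/and5P: certified => _ /allP ltW _ _ _ jN; rewrite /run /word -map_comp.
rewrite (iffLR (eq_in_map _ id _)) ?map_id // => i iW; rewrite /= inordK //.
by apply: (allP (ltW (nth [::] W j) _)); rewrite ?mem_nth.
Qed.

Lemma wordK j : j < N -> state (cl (word j)) = j.
Proof.
case/and5P: certified => _ _ /allP H _ _ jN; rewrite stateE run_word //.
by apply/eqP/H; rewrite mem_iota.
Qed.

Lemma cl_run u j : j < N -> cl (word (run u j)) = cl (u ++ word j).
Proof.
move=> jN; elim: u => //= i u IH; rewrite (LC_cons i (u ++ _)) -IH -(LC_cons i).
by rewrite /word transition ?run_lt ?ltn_ord //= inord_val.
Qed.

(** Running a word from the empty normal form rewrites it within its class, so the final position
    still names the element. With [wordK], positions and elements are in bijection. *)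
Lemma stateK : cancel state (fun j => cl (word j)).
Proof.
move=> s; have [u ->] := class_of_word_surj s.
rewrite stateE cl_run ?size_gt0 //.
suff -> : word 0 = [::] by rewrite cats0.
by case/andP: certified => + _; rewrite /word; case: W => //= w W' /eqP->.
Qed.

Lemma state_mul s t :
  state (s * t)%g = foldr (act D) (state t) (nth [::] W (state s)).
Proof.
have [v ->] := class_of_word_surj t.
rewrite -{1}(stateK s) -LC_cat !stateE -run_word ?state_lt //.
by rewrite /run map_cat foldr_cat.
Qed.

Lemma state_sum (F : nat -> bool) :
  (\sum_(s : LC n) F (state s) = \sum_(0 <= j < N) F j)%R.
Proof.
have: perm_eq (map state (enum {: LC n})) (index_iota 0 N).
  apply: uniq_perm; [|exact: iota_uniq|].
    by rewrite map_inj_uniq ?enum_uniq //; exact: can_inj stateK.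
  move=> j; rewrite mem_index_iota.
  apply/mapP/idP => [[s _ ->]|jN]; first exact: state_lt.
  by exists (cl (word j)); rewrite ?wordK // mem_enum.
by move=> P; rewrite -(perm_big _ P) big_map big_enum.
Qed.

Lemma certificate_det (K : numFieldType) : semigroup_det K (LC n) != 0%R.
Proof.
set M := gram D W L.
case/and5P: certified => _ _ _ _ /and4P[_ /allP szC szC1 /allP MC].
set C := inverse_bits _ in szC szC1 MC.
apply: (@semigroup_det_neq0 _ K (fun s => state s \in L)
  (fun u t => nth false (nth [::] C (state t)) (state u))) => s t.
rewrite -(can_eq stateK) -(eqP (allP (MC (state s) _) (state t) _));
  rewrite ?mem_iota ?state_lt // foldrE big_map (big_nth (false, false)).
rewrite size_zip (nth_map [::]) ?state_lt // size_map size_iota.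
have -> : size (nth [::] C (state t)) = N.
  by apply/eqP/szC/mem_nth; rewrite (eqP szC1) state_lt.
rewrite minnn; pose F k := ((foldr (act D) k (nth [::] W (state s)) \in L) *
  nth false (nth [::] C (state t)) k)%R.
transitivity (\sum_(u : LC n) F (state u))%R.
  by apply: eq_bigr => u _; rewrite /F -state_mul.
rewrite state_sum.
apply: eq_big_nat => k /andP[_ kN]; rewrite nth_zip; last first.
  rewrite size_map size_iota; apply/esym/eqP/szC/mem_nth.
  by rewrite (eqP szC1) state_lt.
by rewrite (nth_map 0) ?size_iota // nth_iota.
Qed.

End Certificate.

Lemma LC_certificate_det (K : numFieldType) n :
  LC_certificate n.+1 -> semigroup_det K (LC n.+1) != 0%R.
Proof.
rewrite /LC_certificate; set rs := iter _ _ _; set W := normal_words _ _.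
set D := transitions _ _ _ => cert; apply: (certificate_det cert) => i j i_n jN.
(* [index] returns the size of [W] for a missing word, so this bound says that the product is listed
   in [W]. *)
have := act_lt cert i_n jN.
rewrite /D /transitions /act (nth_map 0) ?size_iota // nth_iota //.
rewrite (nth_map [::]) // index_mem => pW; rewrite nth_index //.
rewrite -[LHS]eval_generators eval_word_push; last first.
  exact/complete_step_sound/complete_step_sound/LC_equations_sound.
by rewrite eval_generators [RHS](@LC_cons n.+1).
Qed.

Lemma LC_certified n : n \in iota 1 7 -> LC_certificate n.
Proof. by apply/allP; vm_compute. Qed.

Lemma LC_det_small (K : numFieldType) n :
  0 < n < 8 -> semigroup_det K (LC n) != 0%R.
Proof.
case: n => [|n] n8; first by [].
have n17 : n.+1 \in iota 1 7 by rewrite mem_iota.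
exact: (LC_certificate_det K (LC_certified n17)).
Qed.

(** * Determinants for at least 8 generators *)

Section Ascents.
Local Open Scope group_scope.
Variable n : nat.
Hypothesis n4 : 4 < n.
Implicit Types i : 'I_n.
Local Notation s := (@ordS n).
Local Notation a i := (class_of_word (@LC_rel n) [:: i] : LC n).

Let n3 : 3 < n := ltnW n4.

Lemma LC_commSSS i (t : LC n) :
  a i * (a (s (s (s i))) * t) = a (s (s (s i))) * (a i * t).
Proof.
rewrite !mulgA LC_comm_gen //.
  by move/ordS_inj; apply: ordSS_neq; lia.
move=> /(congr1 (@nat_of_ord n)); rewrite !val_ordS.
by have := ltn_ord i; do !case: eqP; lia.
Qed.

(** Expanding both descents by the braid relation brings [a i] next to [a (s (s i))], and this
    product absorbs [a (s i)] on either side. *)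
Lemma LC_desc3 i (t : LC n) :
  a (s (s i)) * (a (s i) * (a i * t)) = a i * (a (s (s i)) * t).
Proof.
rewrite -LC_asc1 -(LC_asc1 i) -LC_commSS // LC_skip2 // LC_skip3 //.
by rewrite -LC_commSS // LC_idemt.
Qed.

(** This and the next four lemmas say, without subtraction, which generators kill e(i) from the
    left: those with index i+1, i+2, i+3, i-1 and i-2. *)
Lemma LC_commutatorS i (t : LC n) :
  a (s i) * (a i * (a (s i) * t)) = a (s i) * (a (s i) * (a i * t)).
Proof. by rewrite LC_asc2 LC_idemt. Qed.

Lemma LC_commutatorSS i (t : LC n) :
  a (s (s i)) * (a i * (a (s i) * t)) = a (s (s i)) * (a (s i) * (a i * t)).
Proof. by rewrite LC_desc3 -LC_commSS // LC_skip3. Qed.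

Lemma LC_commutatorSSS i (t : LC n) :
  a (s (s (s i))) * (a i * (a (s i) * t)) =
    a (s (s (s i))) * (a (s i) * (a i * t)).
Proof.
(* Inserting [a (s (s i))] by the skip relation makes [a (s i)] removable; both sides become a_i
   a_(i+2) a_(i+3) t. *)
rewrite -LC_commSSS -!(LC_commSS (s i)) // -(LC_skipt (s i)) LC_skipt.
by rewrite -[RHS]LC_skip2 // -LC_commSSS LC_desc3.
Qed.

Lemma LC_commutatorP i (t : LC n) :
  a i * (a (s i) * (a (s (s i)) * t)) = a i * (a (s (s i)) * (a (s i) * t)).
Proof. by rewrite LC_skipt LC_skip3. Qed.

Lemma LC_commutatorPP i (t : LC n) :
  a i * (a (s (s i)) * (a (s (s (s i))) * t)) =
    a i * (a (s (s (s i))) * (a (s (s i)) * t)).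
Proof.
(* Inserting [a (s i)] makes [a (s (s i))] removable; both sides become a_i a_(i+1) a_(i+3) t, up to
   commutation. *)
rewrite -(LC_skipt i (_ * t)) (LC_skipt (s i)) (LC_commSSS i (_ * t)).
rewrite -(LC_skipt i) -LC_commSSS.
by rewrite -(LC_commSS (s i)) // LC_skip3.
Qed.

End Ascents.

Section Chain.
Local Open Scope ring_scope.
Variables (R : pzRingType) (A : nat -> R).

Fixpoint chain m k : R := if k is k'.+1 then (1 - A m) * chain m.+1 k' else 1.

Lemma chain_comm x m k :
  (forall j, (m <= j < m + k)%N -> x * A j = A j * x) ->
  x * chain m k = chain m k * x.
Proof.
elim: k m => [|k IH] m xA /=; first by rewrite mulr1 mul1r.
have xAm : x * A m = A m * x by apply: xA; lia.
rewrite -mulrA -IH; last by move=> j jm; apply: xA; lia.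
by rewrite !mulrA; congr (_ * _); rewrite mulrBr mulrBl mulr1 mul1r xAm.
Qed.

(** The first factor is killed by idempotence. For [i = m.+1] the first two factors suffice:
    expanding [A i * (1 - A m) * (1 - A i)], the terms cancel by the descent relation. Later
    generators commute past [1 - A m], and induction applies. *)
Lemma chain_annihilated m k i :
  (forall j, (m <= j < m + k)%N -> A j * A j = A j) ->
  (forall j, (m <= j)%N -> (j.+1 < m + k)%N ->
     A j.+1 * A j * A j.+1 = A j.+1 * A j) ->
  (forall j l, (m <= j)%N -> (j.+1 < l < m + k)%N -> A l * A j = A j * A l) ->
  (m <= i < m + k)%N -> A i * chain m k = 0.
Proof.
elim: k m => [|k IH] m idA descA commA im; first by lia.
have {}IH : (m.+1 <= i)%N -> A i * chain m.+1 k = 0.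
  by move=> mi; apply: IH => *; [apply: idA|apply: descA|apply: commA|]; lia.
have [mi|mi] := leqP i m.
  have {mi}-> : i = m by lia.
  by rewrite /= mulrA mulrBr mulr1 idA ?subrr ?mul0r //; lia.
rewrite /= mulrA mulrBr mulr1; have [mi1|mi1] := leqP i m.+1; last first.
  by rewrite commA ?mulrBl ?IH -?mulrA ?IH ?mulr0 ?subr0 //; lia.
have {mi mi1}Ei : i = m.+1 by lia.
case: k IH idA descA commA im => [|k] IH idA descA commA im; first by lia.
rewrite Ei /= !mulrA mulrBl !mulrBr !mulr1 idA ?descA ?subrr ?mul0r //; lia.
Qed.

End Chain.

Section LeftSocle.
Local Open Scope ring_scope.
Variables (R : pzRingType) (m : nat).
Let n := m.+1.
Hypothesis n7 : (7 < n)%N.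
Local Notation a j := (class_of_word (@LC_rel n) [:: inord j] : LC n).
Local Notation s := (@ordS n).
Variable rho : LC n -> R.
Hypothesis rhoM : forall x y, rho (x * y)%g = rho x * rho y.

(* The element v of the header, where A j is a_(j+1). *)
Definition socle_elt (A : nat -> R) : R :=
  (A 0%N * A 1%N - A 1%N * A 0%N) * chain A 5 (n - 7) * A 4%N.
Let A j := rho (a j).

Lemma inordS j : (j.+1 < n)%N -> inord j.+1 = s (inord j).
Proof.
by move=> jn; apply: ord_inj; rewrite val_ordS !inordK //; [case: eqP; lia|lia].
Qed.

Lemma inord0 : inord 0 = s (inord m).
Proof. by apply: ord_inj; rewrite val_ordS !inordK // eqxx. Qed.

Lemma gen_comm i j : (i < n)%N -> (j < n)%N -> (i.+1 < j)%N -> (j < i + m)%N ->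
  A j * A i = A i * A j.
Proof.
move=> i_n jn ij ji; rewrite -!rhoM LC_comm_gen //.
  by move/(congr1 (@nat_of_ord n)); rewrite val_ordS !inordK //; case: eqP; lia.
by move/(congr1 (@nat_of_ord n)); rewrite val_ordS !inordK //; case: eqP; lia.
Qed.

Lemma gen_idem i : A i * A i = A i.
Proof.
rewrite -rhoM; have := LC_idemt (inord i : 'I_n) 1%g.
by rewrite !mulg1 => ->.
Qed.

Lemma gen_asc1 i : (i.+1 < n)%N -> A i * A i.+1 * A i = A i.+1 * A i.
Proof.
move=> i_n; rewrite -!rhoM -mulgA inordS //.
by have := LC_asc1 (inord i : 'I_n) 1%g; rewrite !mulg1 => ->.
Qed.

Lemma gen_asc2 i : (i.+1 < n)%N -> A i.+1 * A i * A i.+1 = A i.+1 * A i.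
Proof.
move=> i_n; rewrite -!rhoM -mulgA inordS //.
by have := LC_asc2 (inord i : 'I_n) 1%g; rewrite !mulg1 => ->.
Qed.

Lemma gen_commutator j : (j < n)%N -> (0 < j < 4)%N || (m.-1 <= j)%N ->
  A j * (A 0%N * A 1%N - A 1%N * A 0%N) = 0.
Proof.
move=> jn Hj; rewrite mulrBr -!rhoM; apply/eqP; rewrite subr_eq0; apply/eqP.
congr rho; have n4 : (4 < n)%N by lia.
have e1 : inord 1 = s (inord 0) by apply: inordS; lia.
have e2 : inord 2 = s (s (inord 0)) by rewrite inordS ?e1 //; lia.
have e3 : inord 3 = s (s (s (inord 0))) by rewrite inordS ?e2 //; lia.
have em : inord m = s (inord m.-1).
  by rewrite -inordS; [congr inord; lia|lia].
have [->|[->|[->|[->|->]]]] :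
    (j = 1 \/ j = 2 \/ j = 3 \/ j = m \/ j = m.-1)%N by lia.
- rewrite e1; have := LC_commutatorS (inord 0 : 'I_n) 1%g.
  by rewrite !mulg1.
- rewrite e2 e1; have := LC_commutatorSS n4 (inord 0 : 'I_n) 1%g.
  by rewrite !mulg1.
- rewrite e3 e1; have := LC_commutatorSSS n4 (inord 0 : 'I_n) 1%g.
  by rewrite !mulg1.
- rewrite e1 inord0; have := LC_commutatorP n4 (inord m : 'I_n) 1%g.
  by rewrite !mulg1.
- rewrite e1 inord0 em; have := LC_commutatorPP n4 (inord m.-1 : 'I_n) 1%g.
  by rewrite !mulg1.
Qed.

(** Indices 1, 2, 3, [m.-1] and [m] kill the commutator. Indices from 5 to [m - 2] commute with it
    and kill the chain. Index 0 fixes the commutator, and index 4 passes through it to reach the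
    final [A 4]. *)
Lemma socle_eltP j : (j < n)%N ->
  A j * socle_elt A = if (j == 0)%N || (j == 4)%N then socle_elt A else 0.
Proof.
move=> jn; rewrite /socle_elt.
have [j0|j0] := eqVneq j 0%N.
  rewrite j0 /= !mulrA mulrBr !mulrA gen_idem gen_asc1 //; lia.
have A4 i : (5 < i < 5 + (n - 7))%N -> A 4%N * A i = A i * A 4%N.
  by move=> *; rewrite -gen_comm //; lia.
have commN i : (3 < i)%N -> (i < m.-1)%N ->
    A i * (A 0%N * A 1%N - A 1%N * A 0%N) =
      (A 0%N * A 1%N - A 1%N * A 0%N) * A i.
  move=> i3 im; have i0 : A i * A 0%N = A 0%N * A i by apply: gen_comm; lia.
  have i1 : A i * A 1%N = A 1%N * A i by apply: gen_comm; lia.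
  by rewrite mulrBr mulrBl !mulrA i0 i1 -!mulrA i0 i1.
have [j4|j4] := eqVneq j 4%N.
  rewrite j4 /= !mulrA commN; [|lia|lia]; rewrite -!mulrA; congr (_ * _).
  (* As n >= 8, the chain has a first factor; [A 4] commutes with all others, and
     [A 4 * (1 - A 5) * A 4 = (1 - A 5) * A 4]. *)
  have -> : (n - 7 = (n - 8).+1)%N by lia.
  rewrite /= -!mulrA -chain_comm; last by move=> i im; apply: A4; lia.
  rewrite !mulrA mulrBr mulrBl mulr1.
  by rewrite gen_asc1 ?mulrBl ?mul1r ?gen_idem //; lia.
rewrite !mulrA /=; have [j3|j3] := boolP ((0 < j < 4)%N || (m.-1 <= j)%N).
  by rewrite gen_commutator // !mul0r.
rewrite commN; [|lia|lia].
rewrite -(mulrA _ (A j)) chain_annihilated ?mulr0 ?mul0r //; first last.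
- lia.
- by move=> i l *; apply: gen_comm; lia.
- by move=> i *; apply: gen_asc2; lia.
- by move=> i _; exact: gen_idem.
Qed.

End LeftSocle.

Section Automaton.

(* A left action on pairs (b, c), with None as zero, separating v from v a_6: *)
(* a_1 and a_2 act on b, a_5 and a_6 act on c, and the other generators kill  *)
(* everything; there e(1) moves b from true to false.                         *)
Definition step (i : nat) (x : option (bool * bool)) : option (bool * bool) :=
  if x is Some (b, c) then
    match i with
    | 0 => Some (false, c)
    | 1 => if b then Some (true, c) else None
    | 4 => Some (b, false)
    | 5 => if c then Some (b, true) else None
    | _ => None
    end
  else None.

Lemma step_None i x : i \notin [:: 0; 1; 4; 5]%N -> step i x = None.
Proof. by case: x => // -[b c]; case: i => [|[|[|[|[|[|i]]]]]]. Qed.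

Lemma step_rel n (u v : seq 'I_n) x : (7 < n)%N -> LC_rel u v ->
  foldr step x (map val u) = foldr step x (map val v).
Proof.
have stepN i : step i None = None by [].
move=> n7 [i|i j ij ij1 ij2|i j ij|i j ij|i j i_max j0|i j i_max j0|i] /=.
- case: x => // -[b c].
  by case: (val i) => [|[|[|[|[|[|k]]]]]] //=; case: b c => [] [].
- have [iN|iS] := boolP (val i \notin [:: 0; 1; 4; 5]%N).
    by rewrite !(step_None _ iN) stepN.
  have [jN|jS] := boolP (val j \notin [:: 0; 1; 4; 5]%N).
    by rewrite !(step_None _ jN) stepN.
  move: iS jS ij; rewrite !negbK !inE /=; case: x => [[b c]|] //.
  by do 2!case/or4P=> /eqP->; case: b c => [] [] //= []; try lia.
- rewrite ij; case: x => // -[b c].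
  by case: (val i) => [|[|[|[|[|[|k]]]]]] //=; case: b c => [] [].
- rewrite ij; case: x => // -[b c].
  by case: (val i) => [|[|[|[|[|[|k]]]]]] //=; case: b c => [] [].
- by rewrite !(@step_None i) ?stepN // i_max !inE; lia.
- by rewrite !(@step_None i) ?stepN // i_max !inE; lia.
- have [iN|iS] := boolP (val i \notin [:: 0; 1; 4; 5]%N).
    by rewrite !(step_None _ iN).
  (* For i in 0, 1, 4, 5 the letter i+2 is 2, 3, 6 or 7, which kills everything; n >= 8 keeps 5+2
     from wrapping round to 0. *)
  have i6 : (i < 6)%N by move: iS; rewrite negbK !inE => /or4P[] /eqP /= ->.
  have E j : (j < 7)%N -> (j.+1 == n) = false by lia.
  rewrite !(@step_None (ordS (ordS i))) ?stepN // !val_ordS.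
  rewrite !(E i) ?(E i.+1) //; try lia.
  by move: iS; rewrite negbK !inE /= => /or4P[] /eqP->.
Qed.

Variable n : nat.
Hypothesis n7 : (7 < n)%N.

Definition step_class (z : LC n) x :=
  foldr step x (map val (repr z : seq 'I_n)).

Lemma step_classE (w : seq 'I_n) x :
  step_class (class_of_word (@LC_rel n) w) x = foldr step x (map val w).
Proof.
have: word_cong (@LC_rel n) (repr (class_of_word (@LC_rel n) w)) w.
  exact: cong_repr.
rewrite /step_class; move: (repr _) => r; elim=> {r w} // [u v w _ -> _ -> //|].
by move=> u1 u v u2 uv; rewrite !map_cat !foldr_cat (step_rel _ n7 uv).
Qed.

Lemma step_classM (i : 'I_n) (t : LC n) x :
  step_class (class_of_word (@LC_rel n) [:: i] * t : LC n)%g x =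
    step i (step_class t x).
Proof.
have [w ->] := class_of_word_surj t.
by rewrite -(@LC_cons n) !step_classE.
Qed.

End Automaton.

Section LargeDeterminant.
Local Open Scope ring_scope.
Variables (P : idomainType) (m : nat).
Let n := m.+1.
Hypothesis n7 : (7 < n)%N.
Local Notation a j := (class_of_word (@LC_rel n) [:: inord j] : LC n).
Let S : finSemigroupType := LC n.
Let rho : LC n -> 'M[P]_#|S| := @regular_mx P S.
Let A j := rho (a j).

Let phi (F : option (bool * bool) -> P) x : 'rV[P]_#|S| :=
  @functional P S (fun t : LC n => F (step_class t x)).

(** Right multiplication by [A j] precomposes a functional with left multiplication by the
    generator, whose letter acts last on [x]. *)
Lemma phi_gen F x j : (j < n)%N -> phi F x *m A j = phi (F \o step j) x.
Proof.
move=> jn; rewrite [LHS]functional_regular; apply/rowP => k; rewrite !mxE /=.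
by rewrite (step_classM n7) inordK.
Qed.

Lemma phi_eq F G x : F =1 G -> phi F x = phi G x.
Proof. by move=> FG; apply/rowP => k; rewrite !mxE FG. Qed.

Lemma phi_chain F x l k :
  (forall j y, (l <= j)%N -> F (step j y) = 0) -> (l + k <= n)%N ->
  phi F x *m chain A l k = phi F x.
Proof.
elim: k l => [|k IH] l F0 lk; first exact: mulmx1.
rewrite /= mulmxA mulmxBr mulmx1 phi_gen; last by lia.
rewrite (_ : phi (F \o step l) x = 0).
  by rewrite subr0 IH // => [j y lj|]; [apply: F0|]; lia.
by apply/rowP => i; rewrite !mxE /= F0.
Qed.

(** The commutator turns the indicator of (false, false) into that of (true, false). The chain
    changes nothing, as no letter from 5 on leads to a state with second component false. Finally
    [A 4] resets that component, so its value becomes irrelevant. *)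
Lemma phi_socle_elt x :
  phi (fun y => (y == Some (false, false))%:R) x *m socle_elt m A =
  phi (fun y => (if y is Some (true, _) then true else false)%:R) x.
Proof.
rewrite /socle_elt !mulmxA !mulmxBr !mulmxA !phi_gen; try by lia.
rewrite (_ : _ - _ = phi (fun y => (y == Some (true, false))%:R) x).
  rewrite phi_chain; [|by case=> [|[|[|[|[|[|j]]]]]] [[[] []]|]|by lia].
  by rewrite phi_gen; [apply: phi_eq => -[[[] []]|]|lia].
apply/rowP => k; rewrite !mxE /=.
by case: step_class => [[[] []]|] /=; rewrite ?subr0 ?subrr.
Qed.

Lemma LC_cayley_det0 f : \det (cayley_mx (f : S -> P)) = 0.
Proof.
have V j := @socle_eltP _ m n7 rho (fun x y => regular_mxM P x y) j.
rewrite -/A in V.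
have scalar (z : LC n) : exists c, rho z *m socle_elt m A = c *: socle_elt m A.
  have [w ->] := class_of_word_surj z; elim: w => [|i w [c IH]].
    exists 1; rewrite scale1r [rho _](_ : _ = 1%:M) ?mul1mx //.
    apply/matrixP => i j; rewrite !mxE -(inj_eq enum_val_inj).
    by rewrite [X in (_ == X)](@mul1g (LC n)).
  rewrite (@LC_cons n) [rho _]regular_mxM -mulmxA IH -scalemxAr.
  have -> : rho (class_of_word (@LC_rel n) [:: i] : LC n) *m socle_elt m A =
      if (val i == 0)%N || (val i == 4)%N then socle_elt m A else 0.
    by have := V i (ltn_ord i); rewrite {1}/A inord_val.
  by case: ifP => _; [exists c|exists 0; rewrite scaler0 scale0r].
pose y1 := socle_elt m A *m @point P S (1%g : LC n).
pose y2 := socle_elt m A *m @point P S (a 5).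
have reduction := @cayley_mx_det0 P S f y1 y2.
apply: reduction => [z|b c bc0].
  have [c Vc] := scalar z.
  have Vy (y : 'cV_#|S|) :
      rho z *m (socle_elt m A *m y) = c *: (socle_elt m A *m y).
    by rewrite mulmxA Vc scalemxAl.
  by exists c; split; exact: Vy.
pose G (y : option (bool * bool)) : P :=
  (if y is Some (true, _) then true else false)%:R.
have val_at (t : S) x : phi (fun y => (y == Some (false, false))%:R) x *m
    (socle_elt m A *m @point P S t) = (G (step_class t x))%:M.
  by rewrite mulmxA phi_socle_elt; exact: functional_point.
have E x : b * G x + c * G (step 5 x) = 0.
  have := congr1 (mulmx (phi (fun y => (y == Some (false, false))%:R) x)) bc0.
  rewrite mulmx0 mulmxDr -!scalemxAr (val_at 1%g) (val_at (a 5)).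
  rewrite !step_classE // => /matrixP/(_ 0 0).
  by rewrite !mxE eqxx /= !mulr1n inordK //; lia.
(* Letter 5 kills (true, false), which leaves b = 0, and fixes (true, true), which gives b + c =
   0. *)
have := E (Some (true, false)); have := E (Some (true, true)).
by rewrite /G /= !mulr1 mulr0 addr0 => + b0; rewrite b0 add0r.
Qed.

End LargeDeterminant.

Unset Implicit Arguments.
Local Open Scope ring_scope.
Local Open Scope complex_scope.

Theorem theorem4p2 (R : realType) (n : nat) (n_ge1 : (1 <= n)%N) :
  semigroup_det R[i] (LC n) <> 0 <-> (n < 8)%N.
Proof.
split=> [det_neq0|n8]; last first.
  by apply/eqP; apply: LC_det_small; rewrite n_ge1.
case: n n_ge1 det_neq0 => // m _ det_neq0; rewrite ltnNge.
apply/negP => n8; apply: det_neq0.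
(* Over the polynomial ring, with the variables as values, the Cayley matrix is the generic one
   itself. *)
exact: (LC_cayley_det0 n8 (fun s => 'X_(enum_rank s))).
Qed.
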